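(* Let $\mathfrak g=\mathcal W_1^{++}=\mathrm{Span}\{d_i: i\in\mathbb Z_+\}$ with brackets $[d_m,d_n]=(m-n)d_{m+n}$. Fix $k\in\mathbb N$ and let $\mathfrak p_k=\mathrm{Span}\{d_i: i\ge k\}$. Let $\phi_k:\mathfrak p_k\to\mathbb C$ be a nonzero Lie algebra homomorphism. Then the universal quasi-Whittaker module $W(\phi_k)=\mathcal U(\mathfrak g)\otimes_{\mathcal U(\mathfrak p_k)}\mathbb C w_{\phi_k}$ is irreducible if and only if $\phi_k(d_{2k-1})\neq0$ or $\phi_k(d_{2k})\neq0$.
   Context: $\mathbb Z_+$ denotes the nonnegative integers and $\mathbb N$ the positive integers. A Lie algebra homomorphism $\phi_k:\mathfrak p_k\to\mathbb C$ is a linear map vanishing on $[\mathfrak p_k,\mathfrak p_k]=\mathrm{Span}\{d_i:i\ge 2k+1\}$. $\mathbb C w_{\phi_k}$ is the one-dimensional $\mathfrak p_k$-module with $pw_{\phi_k}=\phi_k(p)w_{\phi_k}$. *)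

(* Defs.v *)
From HB Require Import structures.
From mathcomp Require Import all_boot all_order all_algebra.
From mathcomp Require Import complex.
From mathcomp Require Import Rstruct.
Set Implicit Arguments. Unset Strict Implicit. Unset Printing Implicit Defensive.
Import Order.TTheory GRing.Theory Num.Theory.
Local Open Scope ring_scope.

Notation C := (complex Rdefinitions.R).

(* The tensor algebra T(g) of g = W_1^{++} = Span{d_i : i in Z_+}.         *)
(* A word u = [:: i1; ...; in] : seq nat stands for the tensor monomial     *)
(* d_{i1} d_{i2} ... d_{in}; an element of T(g) is a finitely supported     *)
(* function from words to C (its coordinates in the monomial basis).        *)
Definition tens := seq nat -> C.

Definition finsupp (f : tens) : Prop :=
  exists s : seq (seq nat), forall w, w \notin s -> f w = 0.

Definition wrd (u : seq nat) : tens := fun w => if w == u then 1 else 0.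

Definition dmul (i : nat) (f : tens) : tens :=
  fun w => match w with
           | i' :: w' => if i' == i then f w' else 0
           | [::] => 0
           end.

Definition tadd (f g : tens) : tens := fun w => f w + g w.
Definition tscale (c : C) (f : tens) : tens := fun w => c * f w.

(* Generators of the two-sided ideal I with U(g) = T(g)/I :
   u (d_i d_j - d_j d_i - [d_i,d_j]) v,  with [d_i,d_j] = (i-j) d_{i+j}. *)
Definition rel_gen (u : seq nat) (i j : nat) (v : seq nat) : tens :=
  fun w => wrd (u ++ [:: i; j] ++ v) w - wrd (u ++ [:: j; i] ++ v) w
           - ((i%:Z - j%:Z)%:~R) * wrd (u ++ [:: i + j] ++ v) w.

(* Generators of the left ideal T(g) (d_i - phi(d_i)), i >= k :
   u (d_i - phi(d_i)). *)
Definition phi_gen (phi : nat -> C) (u : seq nat) (i : nat) : tens :=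
  fun w => wrd (u ++ [:: i]) w - phi i * wrd u w.

(* J = I + T(g).{ d_i - phi(d_i) : i >= k }  (linear span of the generators).
   W(phi_k) = U(g) (x)_{U(p_k)} C w_phi = T(g) / J.                          *)
Inductive Jspan (k : nat) (phi : nat -> C) : tens -> Prop :=
| J0 : Jspan k phi (fun _ => 0)
| Jrel : forall u i j v (c : C) x,
    Jspan k phi x -> Jspan k phi (tadd (tscale c (rel_gen u i j v)) x)
| Jphi : forall u i (c : C) x, (k <= i)%N ->
    Jspan k phi x -> Jspan k phi (tadd (tscale c (phi_gen phi u i)) x).

Definition inJ (k : nat) (phi : nat -> C) (f : tens) : Prop :=
  exists g, Jspan k phi g /\ forall w, f w = g w.

(* g-submodules of W = T(g)/J, represented by their preimages in T(g):
   subspaces of T(g) containing J and stable under the action of every d_i. *)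
Definition is_submod (k : nat) (phi : nat -> C) (S : tens -> Prop) : Prop :=
  (forall f, S f -> finsupp f) /\
  (forall f g, (forall w, f w = g w) -> S f -> S g) /\
  (forall f, inJ k phi f -> S f) /\
  (forall f g, S f -> S g -> S (tadd f g)) /\
  (forall c f, S f -> S (tscale c f)) /\
  (forall i f, S f -> S (dmul i f)).

(* W(phi_k) is irreducible: it is nonzero (the class of 1 = 1 (x) w_phi is
   nonzero) and its only submodules are 0 (preimage J) and W (preimage T(g)). *)
Definition W_irreducible (k : nat) (phi : nat -> C) : Prop :=
  ~ inJ k phi (wrd [::]) /\
  forall S, is_submod k phi S ->
    (forall f, S f -> inJ k phi f) \/ (forall f, finsupp f -> S f).

(* Main.v *)
Require Import Defs.
From HB Require Import structures.
From mathcomp Require Import all_boot all_order all_algebra.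
From mathcomp Require Import complex Rstruct.
From mathcomp Require Import boolp functions ring zify.
Import GRing.Theory Num.Theory.
Local Open Scope ring_scope.

(* That 1 is not in J is shown without a PBW theorem: p_(j+1) is an ideal of
   codimension one in p_j, so coinducing the one-dimensional module from p_k
   up to p_0 = g yields a functional on words killing J and equal to 1 at 1.

   If phi(d_(2k-1)) = phi(d_(2k)) = 0 then phi extends to p_(k-1) with an
   arbitrary value c at d_(k-1), and the resulting proper quotients of W for
   c = 0 and c = 1 have different kernels.

   Otherwise let N be the largest index with phi(d_N) <> 0, so that N is 2k-1
   or 2k.  For the filtration of W by word length, d_i - phi(d_i) (i >= k)
   lowers the degree by one, and its symbol is the derivation
   x_j |-> phi([d_i, d_j]).  For i = N - j these form an invertible triangular
   system, hence some combination of the d_i (d_(N-j) - phi(d_(N-j))) acts as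
   the Euler operator on symbols; so a vector killed by all d_i - phi(d_i) is
   a multiple of the class of 1, and every nonzero submodule contains one. *)

(** * Word-length filtration, lowering operators and the Euler operator *)

Section Filtration.
Context {K : numFieldType} {V : lmodType K}.
Variables (d : nat -> {linear V -> V}) (mono : seq nat -> V).
Variables (J : V -> Prop) (k : nat) (phi : nat -> K).
Hypothesis JD : forall v w, J v -> J w -> J (v + w).
Hypothesis JZ : forall c v, J v -> J (c *: v).
Hypothesis J_d : forall i v, J v -> J (d i v).
Hypothesis d_mono : forall i u, d i (mono u) = mono (i :: u).
Hypothesis J_bracket : forall i j u,
  J (mono [:: i, j & u] - mono [:: j, i & u]
     - (i%:Z - j%:Z)%:~R *: mono ((i + j)%N :: u)).
Hypothesis J_phi : forall i, (k <= i)%N -> J (mono [:: i] - phi i *: mono [::]).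
Hypothesis J0 : J 0.

(** Degree below n modulo J: stage 0 is J itself, and stage 1 adds only the multiples of [mono
    [::]]. *)
Inductive filt (n : nat) : V -> Prop :=
| filt_J v : J v -> filt n v
| filt_mono u : (size u < n)%N -> filt n (mono u)
| filtD v w : filt n v -> filt n w -> filt n (v + w)
| filtZ c v : filt n v -> filt n (c *: v).

Lemma filt0 v : filt 0 v -> J v.
Proof. by elim=> //; eauto. Qed.

Lemma filtN n v : filt n v -> filt n (- v).
Proof. by rewrite -scaleN1r; apply: filtZ. Qed.

Lemma filtB n v w : filt n v -> filt n w -> filt n (v - w).
Proof. by move=> nv nw; apply/filtD/filtN. Qed.

Lemma filt_sum n (I : Type) (r : seq I) (F : I -> V) :
  (forall i, filt n (F i)) -> filt n (\sum_(i <- r) F i).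
Proof.
move=> nF; elim/big_ind: _ => //; [exact: filt_J | exact: filtD].
Qed.

Lemma filtW m n v : (m <= n)%N -> filt m v -> filt n v.
Proof.
move=> le_mn; elim=> {v} [v Jv|u lt_um|v w _ nv _ nw|c v _ nv].
- exact: filt_J.
- exact/filt_mono/(leq_trans lt_um).
- exact: filtD.
- exact: filtZ.
Qed.

Lemma filt_d n i v : filt n v -> filt n.+1 (d i v).
Proof.
elim=> {v} [v Jv|u lt_un|v w _ nv _ nw|c v _ nv].
- exact/filt_J/J_d.
- by rewrite d_mono; apply: filt_mono.
- by rewrite linearD; apply: filtD.
- by rewrite linearZ; apply: filtZ.
Qed.

Lemma filt_comm n i j v : filt n v -> filt n.+1 (d i (d j v) - d j (d i v)).
Proof.
elim=> {v} [v Jv|u lt_un|v w _ nv _ nw|c v _ nv].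
- by apply: filtB; apply/filt_J/J_d/J_d.
- rewrite !d_mono -[_ - _](subrK ((i%:Z - j%:Z)%:~R *: mono ((i + j)%N :: u))).
  by apply: filtD; [apply/filt_J/J_bracket | apply/filtZ/filt_mono].
- by rewrite !linearD /= addrACA; apply: filtD.
- by rewrite !linearZ /= -scalerDr; apply: filtZ.
Qed.

Definition lower i v := d i v - phi i *: v.

Lemma lowerD i v w : lower i (v + w) = lower i v + lower i w.
Proof. by rewrite /lower linearD scalerDr opprD addrACA. Qed.

Lemma lowerZ i c v : lower i (c *: v) = c *: lower i v.
Proof. by rewrite /lower linearZ /= scalerBr !scalerA mulrC. Qed.

Lemma lower_J i v : J v -> J (lower i v).
Proof. by move=> Jv; apply: JD; [apply: J_d | rewrite -scaleNr; apply: JZ]. Qed.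

(* d_i x u = x d_i u + [d_i, x] u, and [d_i, x] is again a multiple of some d_j with k <= j. *)
Lemma lower_mono_cons i x u :
  J (lower i (mono (x :: u)) - d x (lower i (mono u))
     - (i%:Z - x%:Z)%:~R *: d (i + x)%N (mono u)).
Proof.
suff -> : lower i (mono (x :: u)) - d x (lower i (mono u)) =
    mono [:: i, x & u] - mono [:: x, i & u] by rewrite d_mono; apply: J_bracket.
rewrite /lower [d x (_ - _)]linearB [d x (_ *: _)]linearZ /= !d_mono.
by rewrite opprB addrA subrK.
Qed.

(** Commuting d_i past the first letter x leaves d_(i+x), which is the scalar phi(d_(i+x)) plus a
    lowering operator of index still at least k, so induction on the word applies. *)
Lemma filt_lower_mono i u : (k <= i)%N -> filt (size u) (lower i (mono u)).
Proof.
elim: u i => [|x u IHu] i ki /=; first by rewrite /lower d_mono; apply/filt_J/J_phi.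
have := filt_J (size u).+1 _ (lower_mono_cons i x u).
set a := lower _ _; set b := d x _; set c := _ *: _ => nabc.
rewrite -[a](subrK b) -[a - b](subrK c); do 2?apply: filtD => //.
- rewrite /c -[d _ _](subrK (phi (i + x)%N *: mono u)).
  apply/filtZ/filtD; last exact/filtZ/filt_mono.
  exact/(filtW (size u))/IHu/(leq_trans ki)/leq_addr.
- exact/filt_d/IHu.
Qed.

Lemma filt_lower n i v : (k <= i)%N -> filt n.+1 v -> filt n (lower i v).
Proof.
move=> ki; elim=> {v} [v Jv|u lt_un|v w _ nv _ nw|c v _ nv].
- exact/filt_J/lower_J.
- exact/(filtW (size u))/filt_lower_mono.
- by rewrite lowerD; apply: filtD.
- by rewrite lowerZ; apply: filtZ.
Qed.

(** A letter x >= k acts as the scalar phi(d_x) up to lower degree, so only letters below k survive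
    in top degree. *)
Lemma filt_mono_large u : has (leq k) u -> filt (size u) (mono u).
Proof.
elim: u => //= x u IHu /orP[kx|/IHu nu]; last by rewrite -d_mono; apply: filt_d.
rewrite -d_mono -[d x _](subrK (phi x *: mono u)).
apply: filtD; last exact/filtZ/filt_mono.
exact/(filtW (size u))/filt_lower_mono.
Qed.

(* The derivation x_j |-> a j of the polynomial ring in the letters, read on words. *)
Fixpoint pderiv (a : nat -> K) (u : seq nat) : V :=
  if u is x :: u' then a x *: mono u' + d x (pderiv a u') else 0.

Lemma eq_pderiv a b u : {in u, a =1 b} -> pderiv a u = pderiv b u.
Proof.
elim: u => //= x u IHu eq_ab; rewrite eq_ab ?mem_head ?IHu // => y uy.
by rewrite eq_ab // inE uy orbT.
Qed.

Lemma pderiv_sum m (c : 'I_m -> K) (a : 'I_m -> nat -> K) u :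
  \sum_(j < m) c j *: pderiv (a j) u = pderiv (fun x => \sum_(j < m) c j * a j x) u.
Proof.
elim: u => [|x u IHu] /=; first by rewrite big1 // => j _; rewrite scaler0.
rewrite scaler_suml -IHu linear_sum -big_split /=; apply: eq_bigr => j _.
by rewrite scalerDr scalerA linearZ.
Qed.

Lemma filt_pderiv a u : filt (size u) (pderiv a u).
Proof.
elim: u => [|x u IHu] /=; first exact: filt_J.
by apply: filtD; [apply/filtZ/filt_mono | apply: filt_d].
Qed.

Definition bracket_weight i x : K := (i%:Z - x%:Z)%:~R * phi (i + x)%N.

(** When d_i moves past x, the remainder d_(i+x) is replaced by the scalar phi(d_(i+x)); the error
    is a lowering operator applied to the tail, one degree further down. *)
Lemma lower_symbol i u : (k <= i)%N ->
  filt (size u).-1 (lower i (mono u) - pderiv (bracket_weight i) u).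
Proof.
move=> ki; elim: u => [|x u IHu].
  by rewrite /= subr0; apply: (filt_lower_mono i [::]).
(* The truncated predecessor singles out the empty tail: there the induction hypothesis gives
   membership in J, which [d x] preserves. *)
have nd : filt (size u) (d x (lower i (mono u) - pderiv (bracket_weight i) u)).
  by case: u IHu => [|y v] IHv; [exact/filt_J/J_d/filt0 | exact: filt_d IHv].
have /= := filt_J (size u) _ (lower_mono_cons i x u).
set a := lower i (mono (x :: u)); set b := d x (lower i _).
set c := d (i + x)%N _; set z := _%:~R => nabc.
have nc : filt (size u) (z *: lower (i + x)%N (mono u)).
  exact/filtZ/filt_lower_mono/(leq_trans ki)/leq_addr.
have := filtD _ _ _ (filtD _ _ _ nabc nc) nd.
rewrite [d x (_ - _)]linearB -/b /lower -/c scalerBr scalerA -/(bracket_weight i x).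
by rewrite (addrA (a - b - _)) subrK (addrAC a (- b)) addrA subrK opprD addrA.
Qed.

(* Euler's identity sum_i x_i (d/dx_i) = degree. *)
Lemma euler_mono u : all (gtn k) u ->
  filt (size u) (\sum_(i < k) d i (pderiv (fun x => (x == i)%:R) u)
                 - (size u)%:R *: mono u).
Proof.
elim: u => [_|x u IHu /= /andP[xk uk]].
  apply: filt_J; rewrite /= scale0r subr0 big1 // => i _; exact: linear0.
under eq_bigr => i _ do rewrite linearD linearZ /= d_mono.
rewrite big_split /= (bigD1 (Ordinal xk)) //= eqxx scale1r big1 ?addr0; last first.
  by move=> i; rewrite -val_eqE /= eq_sym => /negPf->; rewrite scale0r.
pose P i := pderiv (fun x => (x == i)%:R) u.
rewrite -[X in X - _]/(mono (x :: u) + \sum_(i < k) d i (d x (P i))).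
suff -> : mono (x :: u) + \sum_(i < k) d i (d x (P i)) - (size u).+1%:R *: mono (x :: u)
    = \sum_(i < k) (d i (d x (P i)) - d x (d i (P i)))
      + d x (\sum_(i < k) d i (P i) - (size u)%:R *: mono u).
  apply: filtD; last exact/filt_d/IHu.
  by apply: filt_sum => i; apply/filt_comm/filt_pderiv.
rewrite sumrB [d x (_ - _)]linearB [d x (\sum_(_ < _) _)]linear_sum.
rewrite [d x (_ *: _)]linearZ /= d_mono (addrA (_ - _)) subrK -natr1 scalerDl scale1r.
by rewrite opprD (addrC (- (_ *: _))) (addrC (mono _)) addrA addrK.
Qed.

Variable N : nat.
Hypothesis hN : (2 * k - 1 <= N <= 2 * k)%N.
Hypothesis phiN : phi N != 0.
Hypothesis phi_gtN : forall i, (N < i)%N -> phi i = 0.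

(* Row j holds the values phi([d_(N-j), d_x]), which vanish for x > j. *)
Definition pairing : 'M[K]_k := \matrix_(j, x) bracket_weight (N - j)%N x.

(** The diagonal entries are (N - 2i) phi(d_N), nonzero because 2i <= 2k - 2 < N. *)
Lemma pairing_unit : pairing \in unitmx.
Proof.
rewrite unitmxE det_trig; last first.
  apply/is_trig_mxP => i j lt_ij; rewrite mxE /bracket_weight phi_gtN ?mulr0 //.
  by have := ltn_ord i; have := ltn_ord j; lia.
rewrite unitfE; apply/prodf_neq0 => i _; rewrite mxE /bracket_weight.
have lt_ik := ltn_ord i; rewrite subnK ?mulf_neq0 //; last by lia.
by rewrite intr_eq0 subr_eq0; apply/eqP; lia.
Qed.

(** Inverting [pairing] isolates the partial derivative in x_i as a symbol. The indices N - j are at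
    least k since j < k and N >= 2k - 1. *)
Definition dual_lower (i : 'I_k) v :=
  \sum_(j < k) invmx pairing i j *: lower (N - j)%N v.

Definition euler v := \sum_(i < k) d i (dual_lower i v).

Lemma dual_lower_symbol i u : all (gtn k) u ->
  filt (size u).-1 (dual_lower i (mono u) - pderiv (fun x => (x == i)%:R) u).
Proof.
move=> uk.
have <- : pderiv (fun x => \sum_(j < k) invmx pairing i j
            * bracket_weight (N - j)%N x) u = pderiv (fun x => (x == i)%:R) u.
  apply: eq_pderiv => x /(allP uk) /= xk; pose x' := Ordinal xk.
  have /matrixP/(_ i x') := mulVmx pairing_unit; rewrite !mxE -val_eqE /= eq_sym => <-.
  by apply: eq_bigr => j _; rewrite mxE.
rewrite -pderiv_sum -sumrB; apply: filt_sum => j; rewrite -scalerBr.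
by apply/filtZ/lower_symbol; have := ltn_ord j; lia.
Qed.

Lemma eulerD v w : euler (v + w) = euler v + euler w.
Proof.
rewrite -big_split /=; apply: eq_bigr => i _; rewrite -linearD -big_split /=.
by congr (d i _); apply: eq_bigr => j _; rewrite lowerD scalerDr.
Qed.

Lemma eulerZ c v : euler (c *: v) = c *: euler v.
Proof.
rewrite scaler_sumr; apply: eq_bigr => i _; rewrite -linearZ /= scaler_sumr.
by congr (d i _); apply: eq_bigr => j _; rewrite lowerZ !scalerA mulrC.
Qed.

Lemma dual_lower_closed (P : V -> Prop) i v : P 0 ->
  (forall v w, P v -> P w -> P (v + w)) -> (forall c v, P v -> P (c *: v)) ->
  (forall j, (k <= j)%N -> P (lower j v)) -> P (dual_lower i v).
Proof.
move=> P0 PD PZ Plow; rewrite /dual_lower; elim/big_ind: _ => // j _.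
by apply/PZ/Plow; have := ltn_ord j; lia.
Qed.

Lemma euler_J v : (forall j, (k <= j)%N -> J (lower j v)) -> J (euler v).
Proof.
move=> Jlow; rewrite /euler; elim/big_ind: _ => // i _.
by apply: J_d; apply: (dual_lower_closed J).
Qed.

Lemma filt_euler n v : filt n v -> filt n (euler v).
Proof.
case: n => [/filt0 Jv|n nv].
  by apply/filt_J/euler_J => j _; apply: lower_J.
apply: filt_sum => i; apply/filt_d/(dual_lower_closed (filt n)) => [|||j kj].
- exact: filt_J.
- exact: filtD.
- exact: filtZ.
- exact: filt_lower.
Qed.

(** Only words of length n + 1 with all letters below k matter, and on their symbols [euler]
    multiplies by the degree; all other words already lie in stage n + 1. *)
Lemma euler_eigen n v : filt n.+2 v -> filt n.+1 (euler v - n.+1%:R *: v).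
Proof.
have low w : filt n.+1 w -> filt n.+1 (euler w - n.+1%:R *: w).
  by move=> nw; apply: filtB; [apply: filt_euler | apply: filtZ].
elim=> {v} [v Jv|u|v w _ nv _ nw|c v _ nv].
- exact/low/filt_J.
- rewrite ltnS leq_eqVlt => /orP[/eqP sz_u|]; last by move=> ?; apply/low/filt_mono.
  have [uk|] := boolP (all (gtn k) u); last first.
    rewrite -has_predC => /sub_has large; apply: low; rewrite -sz_u.
    by apply/filt_mono_large/large => x /=; rewrite -leqNgt.
  have := euler_mono u uk; rewrite sz_u; set s := \sum_(i < k) _ => ns.
  rewrite -[euler _](subrK s) -addrA; apply: filtD => //.
  rewrite -sumrB; apply: filt_sum => i; rewrite -linearB; apply: filt_d.
  by have := dual_lower_symbol i u uk; rewrite sz_u.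
- by rewrite eulerD scalerDr opprD addrACA; apply: filtD.
- by rewrite eulerZ scalerA mulrC -scalerA -scalerBr; apply: filtZ.
Qed.

(** Here [euler v] is in J, so the eigenvalue relation puts (n + 1) v one stage lower, and n + 1 is
    invertible. *)
Lemma singular_filt n v : filt n.+2 v ->
  (forall j, (k <= j)%N -> J (lower j v)) -> filt n.+1 v.
Proof.
move=> nv Jlow; suff: filt n.+1 (n.+1%:R *: v).
  by move/(filtZ _ n.+1%:R^-1); rewrite scalerA mulVf ?pnatr_eq0 // scale1r.
rewrite -[_ *: v](subKr (euler v)).
by apply: filtB; [exact/filt_J/euler_J | exact: euler_eigen].
Qed.

(** Descent on the degree: either some [lower j v] stays outside J and has smaller degree, or v is
    singular and itself lies one stage lower. *)
Lemma submodule_contains_cyclic_vector (S : V -> Prop) n v :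
  (forall w, J w -> S w) -> (forall v w, S v -> S w -> S (v + w)) ->
  (forall c v, S v -> S (c *: v)) -> (forall i v, S v -> S (d i v)) ->
  filt n v -> S v -> ~ J v -> S (mono [::]).
Proof.
move=> SJ SD SZ Sd; elim: n v => [|n IHn] v nv Sv nJv.
  by case: nJv; apply: filt0.
case: n IHn nv => [|n] IHn nv.
  (* At stage 1 the vector is c times the class of 1, and c is nonzero because v is not in J. *)
  suff [c Jc] : exists c, J (v - c *: mono [::]).
    have [c0|c0] := eqVneq c 0; first by case: nJv; rewrite c0 scale0r subr0 in Jc.
    rewrite -[mono _](scalerK c0) -[c *: _](subKr v); apply: (SZ).
    by rewrite -scaleN1r; apply: SD => //; apply/SZ/SJ.
  elim: nv => [w Jw|[]// _|w w' _ [c Jc] _ [c' Jc']|a w _ [c Jc]].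
  - by exists 0; rewrite scale0r subr0.
  - by exists 1; rewrite scale1r subrr.
  - by exists (c + c'); rewrite scalerDl opprD addrACA; apply: JD.
  - by exists (a * c); rewrite -scalerA -scalerBr; apply: JZ.
have [Jlow|] := pselect (forall j, (k <= j)%N -> J (lower j v)).
  by apply: (IHn v) => //; apply: singular_filt.
move=> /existsNP[j /not_implyP[kj nJj]].
apply: IHn nJj; first exact: filt_lower.
by apply: SD; [apply: Sd | rewrite -scaleNr; apply: SZ].
Qed.

End Filtration.

(** * Coinduction from p_(j+1) to p_j *)

Section Coinduction.
Context {K : numFieldType} {M : lmodType K}.
Variables (j : nat) (A : nat -> M -> M).

(** The sequence f encodes a right p_(j+1)-linear map U(p_j) -> M by its values at d_j^n. For i > j,
    [coact n i f] is its value at d_i d_j^n, through d_i d_j^(n+1) = d_j d_i d_j^n + (i - j) d_(i+j)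
    d_j^n. *)
Fixpoint coact (n i : nat) (f : nat -> M) : M :=
  if n is n'.+1 then
    coact n' i (fun m => f m.+1) + (i%:Z - j%:Z)%:~R *: coact n' (i + j)%N f
  else A i (f 0%N).

Definition coop i (f : nat -> M) : nat -> M :=
  fun n => if i == j then f n.+1 else coact n i f.

Hypothesis A_lin : forall i, linear (A i).
Hypothesis A_bracket : forall a b v, (j < a)%N -> (j < b)%N ->
  A a (A b v) - A b (A a v) = (b%:Z - a%:Z)%:~R *: A (a + b)%N v.

Lemma coact_linear n i : linear (coact n i).
Proof.
elim: n i => [|n IHn] i c f g /=; first exact: A_lin.
rewrite (IHn _ c (fun m => f m.+1)) IHn !scalerDr addrACA !scalerA.
by rewrite [c * _]mulrC.
Qed.

Lemma coop_linear i : linear (coop i).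
Proof.
move=> c f g; apply/funext => n; rewrite /coop; case: eqP => //= _.
exact: coact_linear.
Qed.

(** Unfolding one factor d_j reduces n + 1 to n for the pairs (a, b), (a, b + j) and (a + j, b). *)
Lemma coact_bracket n a b f : (j < a)%N -> (j < b)%N ->
  coact n a (fun m => coact m b f) - coact n b (fun m => coact m a f)
    = (b%:Z - a%:Z)%:~R *: coact n (a + b)%N f.
Proof.
move=> ja jb; elim: n a b ja jb f => [|n IHn] a b ja jb f /=; first exact: A_bracket.
have expand x y : coact n x (fun m => coact m y (fun l => f l.+1)
      + (y%:Z - j%:Z)%:~R *: coact m (y + j)%N f)
    = (y%:Z - j%:Z)%:~R *: coact n x (fun m => coact m (y + j)%N f)
      + coact n x (fun m => coact m y (fun l => f l.+1)).
  by rewrite -coact_linear; congr coact; apply/funext => m; rewrite addrC.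
rewrite !expand.
have/eqP := IHn a b ja jb (fun l => f l.+1); rewrite subr_eq => /eqP->.
have/eqP := IHn a (b + j)%N ja (ltn_addr j jb) f; rewrite subr_eq => /eqP->.
have/eqP := IHn (a + j)%N b (ltn_addr j ja) jb f; rewrite subr_eq => /eqP->.
rewrite addnA (addnAC a j) !scalerDr !scalerA !PoszD.
set Y1 := coact n b (fun m => coact m a _); set Y2 := coact n (b + j) _.
set Y3 := coact n b (fun m => coact m (a + j) f).
set Z1 := coact n _ _; set Z2 := coact n _ _.
(* The Jacobi identity for d_a, d_b, d_j, read on coefficients. *)
have -> : (b%:Z - a%:Z)%:~R * (a%:Z + b%:Z - j%:Z)%:~R
    = (b%:Z - j%:Z)%:~R * (b%:Z + j%:Z - a%:Z)%:~R
      + (a%:Z - j%:Z)%:~R * (b%:Z - (a%:Z + j%:Z))%:~R :> K.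
  by rewrite -!intrM -intrD; congr (_%:~R); ring.
apply/eqP; rewrite scalerDl subr_eq; apply/eqP.
by rewrite [LHS](AC (2*2*2) ((3*(1*5))*(6*4*2))).
Qed.

Lemma coop_bracket a b f : (j <= a)%N -> (j <= b)%N ->
  coop a (coop b f) - coop b (coop a f) = (b%:Z - a%:Z)%:~R *: coop (a + b)%N f.
Proof.
(* The recursion defining [coact] is exactly the commutator with d_j. *)
have shift i n : (j < i)%N -> coop j (coop i f) n - coop i (coop j f) n
    = (i%:Z - j%:Z)%:~R *: coop (j + i)%N f n.
  move=> ji; rewrite /coop eqxx (gtn_eqF ji) -[X in _ == X]addn0 eqn_add2l.
  by rewrite (gtn_eqF (leq_ltn_trans _ ji)) //= addrAC subrr add0r addnC.
rewrite [(j <= a)%N]leq_eqVlt [(j <= b)%N]leq_eqVlt.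
move=> /predU1P[<-|ja] /predU1P[<-|jb]; apply/funext => n.
- by rewrite !subrr scale0r.
- exact: shift.
- by rewrite -[LHS]opprB [X in - X](shift _ _ ja) -scaleNr -rmorphN opprB addnC.
- rewrite /coop (gtn_eqF ja) (gtn_eqF jb) (gtn_eqF (ltn_addr b ja)).
  exact: coact_bracket.
Qed.

End Coinduction.

(** * An eigenfunctional for p_k on a right g-module *)

Section CyclicFunctional.
Context {K : numFieldType}.

(* Right multiplication reverses the bracket: [A i] is the action v |-> v d_i. *)
Definition has_eigenfunctional (k : nat) (phi : nat -> K) (j : nat) :=
  exists (M : lmodType K) (A : nat -> M -> M) (eps : M -> K) (v : M),
  [/\ forall i, linear (A i), scalar eps,
      forall a b w, (j <= a)%N -> (j <= b)%N ->
        A a (A b w) - A b (A a w) = (b%:Z - a%:Z)%:~R *: A (a + b)%N w,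
      forall i w, (k <= i)%N -> eps (A i w) = phi i * eps w
    & eps v = 1].

(** Start from the one-dimensional module of p_k and coinduce k times, lowering the index by one
    each time. *)
Lemma eigenfunctional (k : nat) (phi : nat -> K) :
  (forall m n : nat, (k <= m)%N -> (k <= n)%N ->
     (m%:Z - n%:Z)%:~R * phi (m + n)%N = 0) ->
  has_eigenfunctional k phi 0.
Proof.
move=> phi_hom; suff: forall l, (l <= k)%N -> has_eigenfunctional k phi (k - l).
  by move/(_ k (leqnn k)); rewrite subnn.
elim=> [_|l IHl lt_lk].
  exists K^o, (fun i w => phi i * w), id, 1; split=> //.
  - by move=> i c v w; rewrite mulrDr; congr (_ + _); apply: mulrCA.
  - move=> a b w; rewrite subn0 => ka kb; rewrite !mulrA [phi a * _]mulrC subrr.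
    by rewrite [RHS]mulrA addnC phi_hom // mul0r.
have [M [A [eps [v [A_lin eps_lin A_bracket eps_phi eps_v]]]]] := IHl (ltnW lt_lk).
have lt_sub i : (k - l.+1 < i)%N -> (k - l <= i)%N by lia.
(* Evaluation at d_j^0 = 1 commutes with the action of d_i for i > j, so the eigenvalue property
   carries over; the constant sequence is one extension of the value v at 1. *)
exists (nat -> M), (coop (k - l.+1) A), (fun f => eps (f 0%N)), (fun=> v); split=> //.
- exact: coop_linear.
- by move=> c f g /=; apply: eps_lin.
- move=> a b f; apply: coop_bracket => // a' b' w /lt_sub ja' /lt_sub jb'.
  exact: A_bracket.
- move=> i f ki; rewrite /coop gtn_eqF ?eps_phi //; lia.
Qed.

End CyclicFunctional.

(** * The tensor algebra, the subspace J, and W nonzero *)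

Lemma tscaleE c (f : tens) : tscale c f = c *: f. Proof. by []. Qed.

Lemma taddE (f g : tens) : tadd f g = f + g. Proof. by []. Qed.

Lemma dmul_linear i : linear (dmul i).
Proof.
move=> c f g; apply/funext => -[|j u]; rewrite /dmul !fctE /=.
  by rewrite scaler0 addr0.
by case: eqP => _; rewrite ?scaler0 ?addr0.
Qed.

HB.instance Definition _ i := GRing.isLinear.Build C tens tens *:%R (dmul i) (dmul_linear i).

Lemma dmul_wrd i u : dmul i (wrd u) = wrd (i :: u).
Proof.
apply/funext => -[|j v] //=; rewrite /wrd eqseq_cons.
by case: (j == i).
Qed.

Lemma rel_genE u i j v : rel_gen u i j v = wrd (u ++ [:: i; j] ++ v)
  - wrd (u ++ [:: j; i] ++ v) - (i%:Z - j%:Z)%:~R *: wrd (u ++ [:: (i + j)%N] ++ v).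
Proof. by []. Qed.

Lemma phi_genE phi u i : phi_gen phi u i = wrd (u ++ [:: i]) - phi i *: wrd u.
Proof. by []. Qed.

Lemma tens_wrd_ind (P : tens -> Prop) : P 0 ->
  (forall c u f, P f -> P (c *: wrd u + f)) -> forall f, finsupp f -> P f.
Proof.
move=> P0 PD f [s]; elim: s f => [|u s IHs] f f0.
  by rewrite (_ : f = 0) //; apply/funext => w; rewrite f0.
rewrite -(subrKC (f u *: wrd u) f); apply/PD/IHs => w ws.
rewrite !fctE /wrd; case: eqP => [->|/eqP wu].
  by rewrite [_ *: _]mulr1 subrr.
by rewrite scaler0 subr0 f0 // inE negb_or wu.
Qed.

Section JspanTheory.
Context {k : nat} {phi : nat -> C}.
Local Notation J := (Jspan k phi).

Lemma inJ_Jspan f : inJ k phi f <-> J f.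
Proof.
split=> [[g [Jg fg]]|Jf]; last by exists f.
by rewrite (_ : f = g) //; apply/funext.
Qed.

Lemma Jspan_rel_gen u i j v : J (rel_gen u i j v).
Proof.
have := Jrel u i j v 1 (J0 k phi).
by rewrite taddE tscaleE scale1r -[X in _ + X]/(0 : tens) addr0.
Qed.

Lemma Jspan_phi_gen u i : (k <= i)%N -> J (phi_gen phi u i).
Proof.
move=> ki; have := Jphi u 1 ki (J0 k phi).
by rewrite taddE tscaleE scale1r -[X in _ + X]/(0 : tens) addr0.
Qed.

Lemma JspanD f g : J f -> J g -> J (f + g).
Proof.
move=> Jf Jg; elim: Jf => [|u i j v c x _ IHx|u i c x ki _ IHx].
- by rewrite -[X in X + _]/(0 : tens) add0r.
- by rewrite taddE -addrA; apply: Jrel.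
- by rewrite taddE -addrA; apply: Jphi.
Qed.

Lemma JspanZ c f : J f -> J (c *: f).
Proof.
elim=> [|u i j v a x _ IHx|u i a x ki _ IHx].
- by rewrite -[X in _ *: X]/(0 : tens) scaler0; apply: J0.
- by rewrite taddE tscaleE scalerDr scalerA; apply: Jrel.
- by rewrite taddE tscaleE scalerDr scalerA; apply: Jphi.
Qed.

Lemma Jspan_sub (P : tens -> Prop) : P 0 ->
  (forall f g, P f -> P g -> P (f + g)) -> (forall c f, P f -> P (c *: f)) ->
  (forall u i j v, P (rel_gen u i j v)) ->
  (forall u i, (k <= i)%N -> P (phi_gen phi u i)) -> forall f, J f -> P f.
Proof.
move=> P0 PD PZ Prel Pphi f; elim=> [//|u i j v c x _ Px|u i c x ki _ Px].
- exact/PD/Px/PZ/Prel.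
- exact/PD/Px/PZ/Pphi.
Qed.

Lemma Jspan_dmul i f : J f -> J (dmul i f).
Proof.
move: f; apply: Jspan_sub => [|f g Jf Jg|c f Jf|u a b v|u a ka].
- by rewrite linear0; apply: J0.
- by rewrite linearD; apply: JspanD.
- by rewrite linearZ; apply: JspanZ.
- rewrite rel_genE !linearB linearZ /= !dmul_wrd.
  exact: (Jspan_rel_gen (i :: u) a b v).
- rewrite phi_genE linearB linearZ /= !dmul_wrd.
  exact: (Jspan_phi_gen (i :: u) a ka).
Qed.

Lemma finsuppD f g : finsupp f -> finsupp g -> finsupp (f + g).
Proof.
move=> [s f0] [t g0]; exists (s ++ t) => w; rewrite mem_cat negb_or => /andP[ws wt].
by rewrite !fctE f0 // g0 // addr0.
Qed.

Lemma finsuppZ c f : finsupp f -> finsupp (c *: f).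
Proof. by move=> [s f0]; exists s => w ws; rewrite !fctE f0 // scaler0. Qed.

Lemma finsupp_wrd u : finsupp (wrd u).
Proof. by exists [:: u] => w; rewrite inE /wrd => /negPf->. Qed.

Lemma Jspan_finsupp f : J f -> finsupp f.
Proof.
have fN g : finsupp g -> finsupp (- g) by rewrite -scaleN1r; apply: finsuppZ.
move: f; apply: Jspan_sub => [|||u i j v|u i _].
- by exists [::].
- exact: finsuppD.
- exact: finsuppZ.
- rewrite rel_genE; apply: finsuppD; last by apply/fN/finsuppZ/finsupp_wrd.
  by apply: finsuppD; [|apply: fN]; apply: finsupp_wrd.
- by rewrite phi_genE; apply: finsuppD; [|apply/fN/finsuppZ]; apply: finsupp_wrd.
Qed.

Hypothesis phi_hom : forall m n : nat, (k <= m)%N -> (k <= n)%N ->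
  ((m%:Z - n%:Z)%:~R : C) * phi (m + n)%N = 0.

(** A finite stand-in for the sum over all words: every duplicate-free list containing the support
    gives the same value. *)
Definition pair_on (lam : seq nat -> C) (s : seq (seq nat)) (f : tens) : C :=
  \sum_(w <- s) f w * lam w.

Lemma pair_on_linear lam s : scalar (pair_on lam s).
Proof.
move=> c f g; rewrite mulr_sumr -big_split; apply: eq_bigr => w _ /=.
by rewrite !fctE mulrDl mulrA.
Qed.

HB.instance Definition _ lam s :=
  GRing.isLinear.Build C tens C *%R (pair_on lam s) (pair_on_linear lam s).

Lemma pair_on_wrd lam s u : uniq s -> u \in s -> pair_on lam s (wrd u) = lam u.
Proof.
move=> s_uniq us; rewrite /pair_on (bigD1_seq u) //= /wrd eqxx mul1r big1 ?addr0 //.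
by move=> w /negPf->; rewrite mul0r.
Qed.

(** The functional sends u to [eps] of v acted on by u from the right. The bracket relations hold in
    the module, and a final letter i >= k is absorbed by [eps] as phi(d_i). *)
Lemma one_notin_J : ~ J (wrd [::]).
Proof.
have [M [A [eps [v [A_lin eps_lin A_bracket eps_phi eps_v]]]]] :=
  eigenfunctional k phi phi_hom.
pose run x u := foldl (fun y i => A i y) x u.
have run_lin u c x y : run (c *: x + y) u = c *: run x u + run y u.
  by elim: u x y => //= i u IHu x y; rewrite A_lin IHu.
pose lam u := eps (run v u).
have lam_rel u i j u' : lam (u ++ [:: i; j] ++ u') - lam (u ++ [:: j; i] ++ u')
    = (i%:Z - j%:Z)%:~R * lam (u ++ [:: (i + j)%N] ++ u').
  rewrite /lam /run !foldl_cat /= -!/(run _ u'); set x := foldl _ _ _.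
  have /eqP := A_bracket j i x isT isT; rewrite subr_eq => /eqP ->.
  by rewrite run_lin eps_lin addrK addnC.
have lam_phi u i : (k <= i)%N -> lam (u ++ [:: i]) = phi i * lam u.
  by move=> ki; rewrite /lam /run foldl_cat /= eps_phi.
(* Asking for vanishing on all large enough lists makes the property stable under sums. *)
suff killed f : J f -> exists s0 : seq (seq nat),
    forall s, uniq s -> {subset s0 <= s} -> pair_on lam s f = 0.
  case/killed=> s0 vanish; have := vanish (undup ([::] :: s0)) (undup_uniq _).
  rewrite pair_on_wrd ?undup_uniq ?mem_undup ?mem_head // /lam /= eps_v => one0.
  suff/one0/eqP : {subset s0 <= undup ([::] :: s0)} by rewrite oner_eq0.
  by move=> w ws; rewrite mem_undup inE ws orbT.
move: f; apply: Jspan_sub => [|f g [s f0] [t g0]|c f [s f0]|u i j u'|u i ki].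
- by exists [::] => s _ _; rewrite linear0.
- exists (s ++ t) => r r_uniq r_sub; rewrite linearD /= f0 ?g0 ?addr0 // => w ws;
  by rewrite r_sub // mem_cat ws ?orbT.
- by exists s => r r_uniq r_sub; rewrite linearZ /= f0 ?mulr0.
- exists [:: u ++ [:: i; j] ++ u'; u ++ [:: j; i] ++ u'; u ++ [:: (i + j)%N] ++ u'].
  move=> s s_uniq s_sub; rewrite rel_genE !linearB linearZ /=.
  by rewrite !pair_on_wrd ?s_sub ?inE ?eqxx ?orbT // lam_rel subrr.
- exists [:: u ++ [:: i]; u] => s s_uniq s_sub; rewrite phi_genE linearB linearZ /=.
  by rewrite !pair_on_wrd ?s_sub ?inE ?eqxx ?orbT // lam_phi // subrr.
Qed.

End JspanTheory.

(** * The two directions of the criterion *)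

Section Irreducibility.
Context (k : nat) (phi : nat -> C).
Hypothesis phi_hom : forall m n : nat, (k <= m)%N -> (k <= n)%N ->
  ((m%:Z - n%:Z)%:~R : C) * phi (m + n)%N = 0.

(** d_i is a nonzero multiple of [d_(i-k), d_k], since i - k > k. *)
Lemma phi_large i : (2 * k < i)%N -> phi i = 0.
Proof.
move=> ki; have k_ik : (k <= i - k)%N by lia.
have/eqP := phi_hom (i - k)%N k k_ik (leqnn k).
rewrite subnK; last by lia.
by rewrite mulf_eq0 intr_eq0 subr_eq0 => /orP[/eqP|/eqP//]; lia.
Qed.

Lemma irreducible_of_top_value N : (2 * k - 1 <= N <= 2 * k)%N -> phi N != 0 ->
  (forall i, (N < i)%N -> phi i = 0) -> W_irreducible k phi.
Proof.
move=> hN phiN phi_gtN; split; first by move/inJ_Jspan; apply: one_notin_J.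
move=> S [S_fin [_ [SJ [SD [SZ Sd]]]]].
have [|/existsNP[f /not_implyP[Sf nJf]]] := pselect (forall f, S f -> inJ k phi f).
  by left.
have [n fn] : exists n, filt wrd (Jspan k phi) n f.
  move/S_fin: Sf; move: f {nJf}; apply: tens_wrd_ind => [|c u f [n fn]].
    by exists 0%N; apply/filt_J/J0.
  exists (maxn (size u).+1 n); apply: filtD.
    by apply/filtZ/filt_mono; rewrite leq_maxl.
  exact: filtW (leq_maxr _ _) fn.
have S1 : S (wrd [::]).
  apply: (submodule_contains_cyclic_vector dmul wrd (Jspan k phi) k phi _ _ _ _ _ _ _ N hN phiN phi_gtN S n f) => //.
  - exact: JspanD.
  - exact: JspanZ.
  - exact: Jspan_dmul.
  - exact: dmul_wrd.
  - by move=> i j u; apply: (Jspan_rel_gen [::]).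
  - by move=> i ki; apply: (Jspan_phi_gen [::]).
  - exact: J0.
  - by move=> g Jg; apply/SJ/inJ_Jspan.
  - by move=> Jf; apply/nJf/inJ_Jspan.
right=> g; move: g; apply: tens_wrd_ind => [|c u g Sg].
  by rewrite -(scale0r (wrd [::])); apply: SZ.
apply: SD => //; apply: SZ; elim: u => // i u IHu.
by rewrite -dmul_wrd; apply: Sd.
Qed.

(* Both vanishing conditions let phi extend to p_(k-1), with any value at d_(k-1). *)
Definition extend (c : C) : nat -> C := fun i => if i == k.-1 then c else phi i.

Lemma Jspan_extend c f : (1 < k)%N -> Jspan k phi f -> Jspan k.-1 (extend c) f.
Proof.
move=> k_gt1; move: f; apply: Jspan_sub => [|||u i j v|u i ki].
- exact: J0.
- exact: JspanD.
- exact: JspanZ.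
- exact: Jspan_rel_gen.
- rewrite (_ : phi_gen phi u i = phi_gen (extend c) u i).
    by apply: Jspan_phi_gen; lia.
  by rewrite !phi_genE /extend gtn_eqF //; lia.
Qed.

Lemma reducible_of_extension : (1 < k)%N -> phi (2 * k - 1)%N = 0 ->
  phi (2 * k)%N = 0 -> ~ W_irreducible k phi.
Proof.
move=> k_gt1 phi1 phi2 [_ irr].
(* Distinct m, n >= k - 1 satisfy m + n >= 2k - 1 > k - 1, so the value c is never met and phi
   vanishes at m + n. *)
have ext_hom c m n : (k.-1 <= m)%N -> (k.-1 <= n)%N ->
    ((m%:Z - n%:Z)%:~R : C) * extend c (m + n)%N = 0.
  move=> km kn; have [->|mn] := eqVneq m n; first by rewrite subrr mul0r.
  rewrite /extend gtn_eqF; last by lia.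
  have [large|small] := ltnP (2 * k) (m + n); first by rewrite phi_large ?mulr0.
  have/orP[/eqP->|/eqP->] : (m + n == 2 * k - 1)%N || (m + n == 2 * k)%N by lia.
    by rewrite phi1 mulr0.
  by rewrite phi2 mulr0.
have wrd_ext c : Jspan k.-1 (extend c) (wrd [:: k.-1] - c *: wrd [::]).
  by have := @Jspan_phi_gen _ (extend c) [::] _ (leqnn k.-1); rewrite phi_genE /extend eqxx; apply.
have [|J_sub|J_full] := irr (Jspan k.-1 (extend 0)).
- split; first by move=> f; apply: Jspan_finsupp.
  split; first by move=> f g /funext->.
  split; first by move=> f /inJ_Jspan; apply: Jspan_extend.
  split; first exact: JspanD.
  by split; [exact: JspanZ | exact: Jspan_dmul].
(* If the kernel for c = 0 were J, it would lie in the kernel for c = 1, which would then contain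
   d_(k-1) and d_(k-1) - 1, hence 1. *)
- have /J_sub/inJ_Jspan/(Jspan_extend 1 _ k_gt1) J1 : Jspan k.-1 (extend 0) (wrd [:: k.-1]).
    by have := wrd_ext 0; rewrite scale0r subr0.
  apply: (one_notin_J (ext_hom 1)); rewrite -[wrd [::]](subKr (wrd [:: k.-1])).
  rewrite -scaleN1r; apply: JspanD => //; apply: JspanZ.
  by have := wrd_ext 1; rewrite scale1r.
- exact/(one_notin_J (ext_hom 0))/J_full/finsupp_wrd.
Qed.

End Irreducibility.

(* phi i stands for phi_k(d_i), i >= k (values for i < k are unused).
   hhom: phi_k is a Lie algebra homomorphism p_k -> C, i.e. it kills
   [d_m, d_n] = (m - n) d_{m+n} for all m, n >= k.                        *)
Theorem theorem4p9 (k : nat) (phi : nat -> C) (hk : (0 < k)%N)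
  (hhom : forall m n : nat, (k <= m)%N -> (k <= n)%N ->
            ((m%:Z - n%:Z)%:~R : C) * phi (m + n)%N = 0)
  (hnz : exists i : nat, (k <= i)%N /\ phi i != 0) :
  W_irreducible k phi <-> (phi (2 * k - 1)%N != 0 \/ phi (2 * k)%N != 0).
Proof.
have large := phi_large k phi hhom.
have [phi2|phi2] := eqVneq (phi (2 * k)%N) 0; last first.
  split=> [_|_]; first by right.
  by apply: (irreducible_of_top_value _ _ hhom (2 * k)) => //; lia.
have [phi1|phi1] := eqVneq (phi (2 * k - 1)%N) 0; last first.
  split=> [_|_]; first by left.
  apply: (irreducible_of_top_value _ _ hhom (2 * k - 1)) => // [|i lt_i]; first by lia.
  have [->//|ne_i] := eqVneq i (2 * k)%N.
  by apply: large; lia.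
split=> [irr|]; last by case.
case: (ltnP 1 k) => [k_gt1|k_le1].
  by case: (reducible_of_extension _ _ hhom k_gt1 phi1 phi2 irr).
(* For k = 1 the indices 2k - 1, 2k and those beyond exhaust p_1, so phi would be zero. *)
have [i [ki /negP[]]] := hnz; apply/eqP.
have k1 : k = 1%N by lia.
move: phi1 phi2 large; rewrite {}k1 => phi1 phi2 large.
case: i ki => [|[|[|i]]] ki //; last exact: large.
by move: ki; rewrite leqn0 => /eqP k0; rewrite k0 in hk.
Qed.
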